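(* For every integer $t\geq 1$, every graph $G$ that does not contain $K^*_{3,t}$ as a minor satisfies, for every integer $r\geq 1$, \[\mathrm{scol}_r(G)\leq 3(2t+1)(2r+1)\quad\text{and}\quad \mathrm{wcol}_r(G)\leq (2t+1)\binom{r+2}{2}(2r+1).\]
   Context: All graphs are finite and simple. $K^*_{3,t}$ is the complete join of $K_3$ and $\overline{K_t}$. For a graph $G$, a linear ordering $\preceq$ of $V(G)$, a vertex $v$ and an integer $r\geq 1$: $S_r(G,\preceq,v)$ is the set of vertices $x$ for which there is a path $v=w_0,w_1,\dots,w_{r'}=x$ with $0\le r'\le r$, $x\preceq v$ and $v\prec w_i$ for all $1\le i\le r'-1$; $W_r(G,\preceq,v)$ is the set of vertices $x$ for which there is such a path with $x\preceq v$ and $x\prec w_i$ for all $1\le i\le r'-1$. $\mathrm{scol}_r(G)$ is the minimum $k$ such that some linear ordering $\preceq$ satisfies $|S_r(G,\preceq,v)|\le k$ for all $v$; $\mathrm{wcol}_r(G)$ is the minimum $k$ such that some linear ordering satisfies $|W_r(G,\preceq,v)|\le k$ for all $v$. *)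

(* Defs.v *)
From HB Require Import structures.
From mathcomp Require Import all_boot.

Set Implicit Arguments.
Unset Strict Implicit.
Unset Printing Implicit Defensive.

Record sgraph := SGraph {
  vertex :> finType;
  adj : rel vertex;
  adj_sym : symmetric adj;
  adj_irrefl : irreflexive adj }.

Section BasicGraphs.

Fact complete_sym n : symmetric (fun i j : 'I_n => i != j).
Proof. by move=> i j; rewrite eq_sym. Qed.

Fact complete_irrefl n : irreflexive (fun i j : 'I_n => i != j).
Proof. by move=> i; rewrite eqxx. Qed.

Definition complete_graph n : sgraph :=
  SGraph (@complete_sym n) (@complete_irrefl n).

Fact edgeless_sym n : symmetric (fun _ _ : 'I_n => false).
Proof. by []. Qed.

Fact edgeless_irrefl n : irreflexive (fun _ _ : 'I_n => false).
Proof. by []. Qed.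

Definition edgeless_graph n : sgraph :=
  SGraph (@edgeless_sym n) (@edgeless_irrefl n).

Variables G H : sgraph.

Definition join_adj (x y : G + H) : bool :=
  match x, y with
  | inl u, inl v => adj u v
  | inr u, inr v => adj u v
  | _, _ => true
  end.

Fact join_sym : symmetric join_adj.
Proof. by move=> [u|u] [v|v] //=; rewrite adj_sym. Qed.

Fact join_irrefl : irreflexive join_adj.
Proof. by move=> [u|u] /=; rewrite adj_irrefl. Qed.

Definition complete_join : sgraph := SGraph join_sym join_irrefl.

End BasicGraphs.

(* The graph K^*_{s,t}: all edges are present except those inside the part of
   size t. *)
Definition Kstar s t : sgraph :=
  complete_join (complete_graph s) (edgeless_graph t).

Definition induced_connected (G : sgraph) (A : {set G}) : Prop :=
  A != set0 /\
  {in A &, forall x y,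
     connect [rel u v : G | [&& u \in A, v \in A & adj u v]] x y}.

(* [phi] assigns to each vertex of H its branch set, the set of vertices of G
   that is contracted onto it. *)
Definition is_minor (H G : sgraph) : Prop :=
  exists phi : H -> {set G},
    [/\ forall u, induced_connected (phi u),
        forall u v, u != v -> [disjoint phi u & phi v]
      & forall u v, adj u v ->
          exists x y, [/\ x \in phi u, y \in phi v & adj x y]].

Definition linear_order (T : finType) (le : rel T) : bool :=
  [&& [forall x, le x x],
      [forall x, forall y, le x y && le y x ==> (x == y)],
      [forall y, forall x, forall z, le x y && le y z ==> le x z]
    & [forall x, forall y, le x y || le y x]].

Section Reachability.

Variables (G : sgraph) (le : rel G).

Definition lt_of (x y : G) : bool := (x != y) && le x y.

(* The tuple [p] is w_1, ..., w_n, where w_0 = v and n is the length of the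
   path. *)
Definition gpath n (v x : G) (p : n.-tuple G) : bool :=
  [&& path (@adj G) v p, uniq (v :: p) & last v p == x].

(* w_1, ..., w_{n-1}; empty when n <= 1. *)
Definition interior n (v : G) (p : n.-tuple G) : seq G := behead (belast v p).

Definition Sreach (r : nat) (v : G) : {set G} :=
  [set x | le x v &&
    [exists n : 'I_r.+1, exists p : n.-tuple G,
       gpath v x p && all (fun w => lt_of v w) (interior v p)]].

Definition Wreach (r : nat) (v : G) : {set G} :=
  [set x | le x v &&
    [exists n : 'I_r.+1, exists p : n.-tuple G,
       gpath v x p && all (fun w => lt_of x w) (interior v p)]].

End Reachability.

Section ColouringNumbers.

Variable G : sgraph.

Definition rel_of_set (L : {set G * G}) : rel G := fun x y => (x, y) \in L.

(* Orderings of V(G) are encoded as sets of pairs so that they form a finite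
   type; [ordering_boundP] restates this in terms of [rel G]. *)
Definition ordering_bound (reach : rel G -> G -> {set G}) (k : nat) : bool :=
  [exists L : {set G * G},
     linear_order (rel_of_set L) &&
     [forall v, #|reach (rel_of_set L) v| <= k]].

Lemma ordering_bound_ex reach : exists k, ordering_bound reach k.
Proof.
exists #|G|; apply/existsP.
exists [set xy : G * G | enum_rank xy.1 <= enum_rank xy.2].
apply/andP; split; last by apply/forallP=> v; apply: max_card.
rewrite /linear_order /rel_of_set; apply/and4P; split.
- by apply/forallP=> x; rewrite inE /=.
- apply/forallP=> x; apply/forallP=> y; apply/implyP; rewrite !inE /=.
  rewrite -eqn_leq => /eqP /val_inj /enum_rank_inj ->; exact: eqxx.
- apply/forallP=> y; apply/forallP=> x; apply/forallP=> z; apply/implyP.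
  by rewrite !inE /= => /andP[]; apply: leq_trans.
- by apply/forallP=> x; apply/forallP=> y; rewrite !inE /= leq_total.
Qed.

Definition min_ordering_bound reach : nat := ex_minn (ordering_bound_ex reach).

Definition scol (r : nat) : nat :=
  min_ordering_bound (fun le => @Sreach G le r).

Definition wcol (r : nat) : nat :=
  min_ordering_bound (fun le => @Wreach G le r).

End ColouringNumbers.

Lemma linear_orderP (T : finType) (le : rel T) :
  reflect [/\ reflexive le, antisymmetric le, transitive le & total le]
          (linear_order le).
Proof.
apply: (iffP and4P) => [[/forallP r a t l]|[r a t l]]; split.
- exact: r.
- by move=> x y xy; move/forallP/(_ x)/forallP/(_ y): a => /implyP/(_ xy)/eqP.
- move=> y x z xy yz; move/forallP/(_ y)/forallP/(_ x)/forallP/(_ z): t.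
  by rewrite xy yz.
- by move=> x y; move/forallP/(_ x)/forallP/(_ y): l.
- exact/forallP.
- by apply/forallP=> x; apply/forallP=> y; apply/implyP=> /a ->.
- apply/forallP=> y; apply/forallP=> x; apply/forallP=> z; apply/implyP.
  by case/andP; apply: t.
- by apply/forallP=> x; apply/forallP=> y; apply: l.
Qed.

Lemma eq_linear_order (T : finType) (le le' : rel T) :
  le =2 le' -> linear_order le -> linear_order le'.
Proof.
move=> e /linear_orderP[r a t l]; apply/linear_orderP; split.
- by move=> x; rewrite -e.
- by move=> x y; rewrite -!e; apply: a.
- by move=> y x z; rewrite -!e; apply: t.
- by move=> x y; rewrite -!e.
Qed.

Lemma eq_Sreach (G : sgraph) (le le' : rel G) r v :
  le =2 le' -> Sreach le r v = Sreach le' r v.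
Proof.
move=> e; apply/setP=> x; rewrite !inE e; congr (_ && _).
apply: eq_existsb => n; apply: eq_existsb => p; congr (_ && _).
by apply: eq_all => w; rewrite /lt_of e.
Qed.

Lemma eq_Wreach (G : sgraph) (le le' : rel G) r v :
  le =2 le' -> Wreach le r v = Wreach le' r v.
Proof.
move=> e; apply/setP=> x; rewrite !inE e; congr (_ && _).
apply: eq_existsb => n; apply: eq_existsb => p; congr (_ && _).
by apply: eq_all => w; rewrite /lt_of e.
Qed.

Lemma ordering_boundP (G : sgraph) (reach : rel G -> G -> {set G}) k :
  (forall le le' v, le =2 le' -> reach le v = reach le' v) ->
  reflect (exists2 le : rel G, linear_order le & forall v, #|reach le v| <= k)
          (ordering_bound reach k).
Proof.
move=> ereach; apply: (iffP existsP) => [[L /andP[lin /forallP b]]|[le lin b]].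
  by exists (rel_of_set L).
exists [set xy | le xy.1 xy.2].
have e : le =2 rel_of_set [set xy : G * G | le xy.1 xy.2].
  by move=> x y; rewrite /rel_of_set inE.
rewrite (eq_linear_order e lin); apply/forallP=> v.
by rewrite -(ereach _ _ v e).
Qed.

Lemma min_ordering_bound_leP (G : sgraph) (reach : rel G -> G -> {set G}) k :
  (forall le le' v, le =2 le' -> reach le v = reach le' v) ->
  reflect (exists2 le : rel G, linear_order le & forall v, #|reach le v| <= k)
          (min_ordering_bound reach <= k).
Proof.
move=> ereach; rewrite /min_ordering_bound; case: ex_minnP => m Pm minm.
apply: (iffP idP) => [mk|/(ordering_boundP k ereach)]; last exact: minm.
have [le lin b] := ordering_boundP m ereach Pm.
by exists le => // v; apply: leq_trans mk.
Qed.

Lemma scol_leP (G : sgraph) r k :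
  reflect (exists2 le : rel G, linear_order le &
             forall v, #|Sreach le r v| <= k)
          (scol G r <= k).
Proof. by apply: min_ordering_bound_leP => le le' v; apply: eq_Sreach. Qed.

Lemma wcol_leP (G : sgraph) r k :
  reflect (exists2 le : rel G, linear_order le &
             forall v, #|Wreach le r v| <= k)
          (wcol G r <= k).
Proof. by apply: min_ordering_bound_leP => le le' v; apply: eq_Wreach. Qed.

(* Main.v *)
Require Import Defs.
From mathcomp Require Import all_boot.
From mathcomp Require Import zify.

(* The vertices are split into connected layers V_0, V_1, ... such that every
   component C of G - (V_0 + ... + V_{n-1}) touches at most two earlier layers,
   and these two are adjacent.  If C touches A and B, take a BFS tree of C rooted
   at a neighbour of A, and let V_n be a minimal parent-closed set of the tree
   that contains the root and a fixed neighbour p of B and separates A from B in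
   C.  By minimality every leaf of V_n other than the root and p is adjacent to
   both sides of the separation; contracting the two sides and the rest of V_n
   gives K^*_{3,s} where s is the number of these leaves, so s < t.  Hence V_n
   is a union of at most t root paths and meets each BFS level in at most t
   vertices, so a ball of radius r in C meets V_n in at most t(2r+1) vertices.
   Ordering the vertices layer by layer, a vertex strongly reaches at most three
   layers, and weakly reaches at most C(r+2,2) layers because the "touches"
   relation between layers is a chordal elimination scheme of width two. *)

Set Implicit Arguments.
Unset Strict Implicit.
Unset Printing Implicit Defensive.

(** * Connectivity inside vertex subsets, separation and hulls *)

Lemma connect_invariant (T : finType) (e : rel T) (P : pred T) (x y : T) :
  (forall u v, P u -> e u v -> P v) -> connect e x y -> P x -> P y.
Proof.
move=> eP /connectP[p ep ->{y}]; elim: p x ep => //= u p IH x /andP[xu up] Px.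
by apply: IH up _; apply: eP xu.
Qed.

Section InducedConnectivity.

Variable G : sgraph.
Implicit Types (A B S : {set G}) (x y z l : G).

Definition rsub S : rel G := [rel u v : G | [&& u \in S, v \in S & adj u v]].

Lemma rsub_csym S : connect_sym (rsub S).
Proof. by apply: sym_connect_sym => x y; rewrite /rsub /= adj_sym andbCA. Qed.

Lemma connect_rsubS S S' x y :
  S \subset S' -> connect (rsub S) x y -> connect (rsub S') x y.
Proof.
move=> /subsetP sS; apply: connect_sub => u v /and3P[/sS uS /sS vS uv].
by apply: connect1; rewrite /rsub /= uS vS.
Qed.

Lemma connect_rsub_mem S x y : connect (rsub S) x y -> x \in S -> y \in S.
Proof. by apply: (connect_invariant (P := mem S)) => u v _ /and3P[]. Qed.

Lemma connected_from S x :
  x \in S -> {in S, forall y, connect (rsub S) x y} -> induced_connected S.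
Proof.
move=> xS cS; split; first by apply/set0Pn; exists x.
by move=> y z yS zS; apply: connect_trans (cS _ zS); rewrite rsub_csym cS.
Qed.

Lemma connected1 x : induced_connected [set x].
Proof. by apply: (@connected_from _ x); rewrite ?inE // => y /set1P->. Qed.

Definition touch A x := [exists a in A, adj a x].

(** Since [connect] is reflexive, this also excludes a single vertex of [S] touching both [A] and
    [B]. *)
Definition separated A B S :=
  [forall x in S, forall y in S,
     touch A x ==> touch B y ==> ~~ connect (rsub S) x y].

Lemma separatedP A B S :
  reflect (forall x y, x \in S -> y \in S -> touch A x -> touch B y ->
             ~~ connect (rsub S) x y)
          (separated A B S).
Proof.
apply: (iffP forall_inP) => [h x y xS yS Ax By|h x xS].
  by move/forall_inP: (h x xS) => /(_ y yS); rewrite Ax By.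
by apply/forall_inP=> y yS; apply/implyP=> Ax; apply/implyP; apply: h.
Qed.

Lemma separated_sym A B S : separated A B S = separated B A S.
Proof.
by apply/separatedP/separatedP => h x y xS yS Ax By; rewrite rsub_csym h.
Qed.

Definition reached A S :=
  [set x in S | [exists y in S, touch A y && connect (rsub S) y x]].

Lemma reached_start A S x : x \in S -> touch A x -> x \in reached A S.
Proof.
by move=> xS Ax; rewrite inE xS; apply/exists_inP; exists x; rewrite ?Ax /=.
Qed.

Lemma reached_step A S x y :
  x \in reached A S -> rsub S x y -> y \in reached A S.
Proof.
rewrite !inE => /andP[xS /exists_inP[z zS /andP[Az zx]]] xy.
case/and3P: (xy) => _ -> _ /=; apply/exists_inP; exists z; rewrite ?Az //=.
exact: connect_trans zx (connect1 xy).
Qed.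

(** The hulls of two layers later serve as two branch sets of the triangle in [Kstar 3 t]. *)
Definition hull A S := A :|: reached A S.

Lemma hull_connected A S : induced_connected A -> induced_connected (hull A S).
Proof.
move=> [/set0Pn[a aA] cA].
have aH : a \in hull A S by rewrite inE aA.
have c1 x : x \in A -> connect (rsub (hull A S)) a x.
  by move=> xA; apply: connect_rsubS (cA a x aA xA); apply: subsetUl.
apply: (connected_from aH) => x /setUP[/c1 //|xR].
move: (xR); rewrite inE => /andP[xS /exists_inP[y yS /andP[Ay yx]]].
pose P := [pred z | (z \in reached A S) && connect (rsub (hull A S)) a z].
suff /andP[] : P x by [].
apply: (connect_invariant _ yx) => [u v /andP[uR au] uv|].
  have vR := reached_step uR uv.
  rewrite /P /= vR; apply: connect_trans au (connect1 _).
  by case/and3P: uv => _ _ uv; rewrite /rsub /= !in_setU uR vR uv !orbT.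
have yR := reached_start yS Ay; rewrite /P /= yR.
have [b bA b_y] := exists_inP Ay.
apply: connect_trans (c1 b bA) (connect1 _).
by rewrite /rsub /= !in_setU bA yR b_y orbT.
Qed.

(** A common vertex could lie only in [S], where it would join a vertex touching [A] to one touching
    [B]. *)
Lemma hull_disjoint A B S :
  [disjoint A & B] -> [disjoint A & S] -> [disjoint B & S] ->
  separated A B S -> [disjoint hull A S & hull B S].
Proof.
move=> AB AS BS /separatedP sep; rewrite disjoint_subset; apply/subsetP=> x.
rewrite !inE negb_or => /orP[xA|/andP[xS /exists_inP[y yS /andP[Ay yx]]]].
  by rewrite (disjointFr AB xA) (disjointFr AS xA).
rewrite (disjointFl BS xS) xS /=; apply/exists_inP=> -[z zS /andP[Bz zx]].
have /negP := sep y z yS zS Ay Bz; apply.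
by apply: connect_trans yx _; rewrite rsub_csym.
Qed.

Lemma touchS A B x : A \subset B -> touch A x -> touch B x.
Proof.
by move=> /subsetP AB /exists_inP[a /AB aB ax]; apply/exists_inP; exists a.
Qed.

(* A path that becomes available with l must use l, so it reaches l from A. *)
Lemma touch_hull A B S l :
  separated A B S -> ~~ separated A B (l |: S) -> touch (hull A S) l.
Proof.
move=> /separatedP sep; apply: contraNT => nAl; apply/separatedP.
have start z : z \in l |: S -> touch A z -> z \in reached A S.
  move=> /setU1P[-> Al|]; last exact: reached_start.
  by rewrite (touchS _ Al) ?subsetUl in nAl.
have step u v : u \in reached A S -> rsub (l |: S) u v -> v \in reached A S.
  move=> uR /and3P[_ /setU1P[->|vS] uv].
    by case/negP: nAl; apply/exists_inP; exists u; rewrite // inE uR orbT.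
  by apply: (reached_step uR); rewrite /rsub /= vS uv !andbT; case/setIdP: uR.
move=> x y xS yS /(start x xS) xR By; apply/negP=> xy.
have: y \in reached A S by apply: (connect_invariant (P := mem (reached A S)) _ xy).
rewrite inE => /andP[yS' /exists_inP[z zS /andP[Az zy]]].
by have := sep z y zS yS' Az By; rewrite zy.
Qed.

End InducedConnectivity.

(** * Thin tree separators from the excluded minor *)

Section Separator.

Variable G : sgraph.
Implicit Types (A B C H K L S : {set G}) (x y z r p l : G).

(** On [C], [d] is the distance from [r], obtained as the index of the first ball containing the
    vertex, and [f] is a parent map towards [r]. *)
Lemma bfs_tree C r :
  r \in C -> induced_connected C ->
  exists (d : G -> nat) (f : G -> G),
    [/\ d r = 0,
        forall x y, rsub C x y -> d y <= (d x).+1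
      & forall x, x \in C -> x != r -> rsub C (f x) x /\ d x = (d (f x)).+1].
Proof.
move=> rC [_ cC].
pose next S := S :|: [set y | [exists x in S, rsub C x y]].
pose ball k := iter k next [set r].
have ballS k x : x \in ball k -> x \in ball k.+1.
  by move=> xk; rewrite /ball iterS /next inE xk.
have ball_next k x y : x \in ball k -> rsub C x y -> y \in ball k.+1.
  move=> xk xy; rewrite /ball iterS /next 2!inE; apply/orP; right.
  by apply/exists_inP; exists x.
have cover x : x \in C -> exists k, x \in ball k.
  move=> xC; pose P := [pred y | y \in C].
  have /connectP[q rq ->] := cC r x rC xC.
  have: exists k, r \in ball k by exists 0; rewrite inE.
  elim: q {1 2 3}r rq => [|z q IH] y //= /andP[yz zq] [k yk].
  by apply: IH zq _; exists k.+1; apply: ball_next yz.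
have [d dP]: exists d : G -> nat, forall x,
    x \in C -> x \in ball (d x) /\ forall k, x \in ball k -> d x <= k.
  apply: (fin_all_exists (P := fun x k => x \in C ->
    x \in ball k /\ forall m, x \in ball m -> k <= m)) => x.
  have [xC|] := boolP (x \in C); last by exists 0.
  by case: (ex_minnP (cover x xC)) => m xm min_m; exists m.
have d_next x y : rsub C x y -> d y <= (d x).+1.
  move=> xy; case/and3P: (xy) => /dP[xd _] /dP[_ min_y] _.
  by apply: min_y; apply: ball_next xd xy.
have d0 : d r = 0.
  by apply/eqP; rewrite -leqn0; apply: (dP r rC).2; rewrite inE.
have [f fP]: exists f : G -> G, forall x,
    x \in C -> x != r -> rsub C (f x) x /\ d x = (d (f x)).+1.
  apply: (fin_all_exists (P := fun x y => x \in C -> x != r ->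
    rsub C y x /\ d x = (d y).+1)) => x.
  have [xC|] := boolP (x \in C); last by exists x.
  have [->|xr] := eqVneq x r; first by exists r.
  have [] := dP x xC; case dx: (d x) => [|k] xk min_x.
    by rewrite inE (negPf xr) in xk.
  move: xk; rewrite /ball iterS /next 2!inE => /orP[/min_x|]; first by rewrite ltnn.
  (* Membership of [y] in ball [k] gives [d y <= k]; the Lipschitz bound along the edge from [y] to
     [x] gives the converse. *)
  case/exists_inP=> y yk yx; exists y => _ _; split=> //.
  case/and3P: (yx) => /dP[_ /(_ k yk) le_yk] _ _.
  by have := d_next _ _ yx; rewrite dx; lia.
by exists d, f.
Qed.

(** [A], [B] and [K] become the triangle; [t] vertices of [L], taken as singletons, become the
    independent part. *)
Lemma Kstar3_minor t A B K L :
  induced_connected A -> induced_connected B -> induced_connected K ->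
  [disjoint A & B] -> [disjoint A & K] -> [disjoint B & K] ->
  [disjoint A & L] -> [disjoint B & L] -> [disjoint K & L] ->
  (exists2 x, x \in B & touch A x) ->
  (exists2 x, x \in K & touch A x) ->
  (exists2 x, x \in K & touch B x) ->
  {in L, forall l, [/\ touch A l, touch B l & touch K l]} ->
  t <= #|L| -> is_minor (Kstar 3 t) G.
Proof.
move=> cA cB cK dAB dAK dBK dAL dBL dKL tAB tAK tBK tL tleL.
pose leaf (i : 'I_t) := enum_val (widen_ord tleL i).
have leafL i : leaf i \in L by apply: enum_valP.
have leaf_inj : injective leaf.
  by move=> i j /enum_val_inj /(congr1 val) /= /val_inj.
pose hub (i : 'I_3) := if val i == 0 then A else if val i == 1 then B else K.
have hub_leaf i l : l \in L -> l \notin hub i.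
  rewrite /hub; case: ifP => _; last case: ifP => _.
  - by move=> lL; rewrite (disjointFl dAL lL).
  - by move=> lL; rewrite (disjointFl dBL lL).
  - by move=> lL; rewrite (disjointFl dKL lL).
have hub_touch i l : l \in L -> exists2 x, x \in hub i & adj x l.
  move=> /tL[/exists_inP hA /exists_inP hB /exists_inP hK].
  by rewrite /hub; case: ifP => _ //; case: ifP.
have hubs (i j : 'I_3) : i < j ->
    [disjoint hub i & hub j] /\ exists2 x, x \in hub j & touch (hub i) x.
  by rewrite /hub; case: i j => [[|[|[|i]]] ?] [[|[|[|j]]] ?].
exists (fun u : Kstar 3 t => match u with inl i => hub i | inr j => [set leaf j] end).
split.
- case=> [i|j]; last exact: connected1.
  by rewrite /hub; case: ifP => _ //; case: ifP.
- case=> [i|i] [j|j] ij.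
  + have: i != j by apply: contraNneq ij => ->.
    rewrite -val_eqE neq_ltn => /orP[/hubs[]//|/hubs[]].
    by rewrite disjoint_sym.
  + by rewrite disjoint_sym disjoints1 hub_leaf.
  + by rewrite disjoints1 hub_leaf.
  + rewrite disjoints1 inE; apply: contraNneq ij => /leaf_inj->.
    exact: eqxx.
- case=> [i|i] [j|j] //= ij.
  + rewrite -val_eqE neq_ltn in ij; case/orP: ij => /hubs[_ [x xj /exists_inP[y yi yx]]].
      by exists y, x.
    by exists x, y; split; rewrite // adj_sym.
  + have [x xi xl] := hub_touch i _ (leafL j).
    by exists x, (leaf j); rewrite inE eqxx.
  + have [x xi xl] := hub_touch j _ (leafL i).
    by exists (leaf i), x; rewrite inE eqxx adj_sym.
Qed.

(** The tree is forgotten in the conclusion: later counting uses only that [d] is Lipschitz along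
    edges and that each level meets [H] in few vertices. *)
Lemma level_separator t C A B :
  ~ is_minor (Kstar 3 t) G ->
  induced_connected A -> induced_connected B -> induced_connected C ->
  [disjoint A & B] -> [disjoint A & C] -> [disjoint B & C] ->
  (exists2 x, x \in B & touch A x) ->
  (exists2 x, x \in C & touch A x) ->
  (exists2 x, x \in C & touch B x) ->
  exists (H : {set G}) (d : G -> nat),
    [/\ [/\ H \subset C, induced_connected H,
            exists2 x, x \in H & touch A x & exists2 x, x \in H & touch B x],
        separated A B (C :\: H),
        forall x y, rsub C x y -> d y <= (d x).+1
      & forall a, #|[set x in H | d x == a]| <= t].
Proof.
move=> noK cA cB cC dAB dAC dBC tAB [r rC tAr] [p pC tBp].
have [d [f [d0 lip fP]]] := bfs_tree rC cC.
have d_pos x : x \in C -> x != r -> d x = (d (f x)).+1 by move=> *; apply: (fP x _ _).2.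
pose up S := [forall x in S, (x != r) ==> (f x \in S)].
have upP S : reflect (forall x, x \in S -> x != r -> f x \in S) (up S).
  apply: (iffP forall_inP) => h x xS; last exact/implyP/h.
  by move=> xr; apply: (implyP (h x xS)).
(* Following parents leads to [r] without leaving [S], by induction on [d]. *)
have up_connected S : S \subset C -> r \in S -> up S -> induced_connected S.
  move=> /subsetP SC rS /upP upS; apply: (connected_from rS) => x xS.
  have [n] := ubnP (d x); elim: n x xS => // n IH x xS dxn.
  have [->|xr] := eqVneq x r; first exact: connect0.
  have [/and3P[_ _ fx] dx] := fP x (SC x xS) xr.
  apply: (connect_trans (IH (f x) (upS x xS xr) _)); first by rewrite dx in dxn.
  by apply: connect1; rewrite /rsub /= upS // xS.
pose good S := [&& S \subset C, r \in S, p \in S, up S & separated A B (C :\: S)].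
have goodC : good C.
  rewrite /good subxx rC pC setDv /=; apply/andP; split.
    by apply/upP=> x xC xr; have [/and3P[]] := fP x xC xr.
  by apply/separatedP=> x y; rewrite inE.
have [H /minsetP[goodH minH] _] := minset_exists goodC.
have /and5P[HC rH pH upH sepH] := goodH.
(* The leaves of [H], except [r] and [p], which [good] forces to stay. *)
pose L := [set l in H | [&& l != r, l != p
                         & ~~ [exists x in H, (x != r) && (f x == l)]]].
have LP l : l \in L -> [/\ l \in H, l != r & l != p].
  by rewrite inE => /and4P[].
have LC l x : l \in L -> x \in H -> x != r -> f x != l.
  rewrite inE => /and4P[_ _ _ nl] xH xr; apply: contra nl => fx.
  by apply/exists_inP; exists x; rewrite // xr.
(* Deleting [l] preserves every clause of [good] but separation, so by minimality separation must
   fail. *)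
have leaf_sep l : l \in L -> ~~ separated A B (l |: (C :\: H)).
  move=> lL; have [lH lr lp] := LP l lL; apply/negP=> sep.
  have: H :\ l = H.
    apply: minH; last exact: subD1set.
    rewrite /good !inE !(eq_sym _ l) lr lp rH pH (subset_trans (subD1set _ _) HC).
    rewrite /=; apply/andP; split; last first.
      suff -> : C :\: (H :\ l) = l |: (C :\: H) by [].
      apply/setP=> x; rewrite !inE negb_and negbK.
      by have [->|] := eqVneq x l => //=; rewrite (subsetP HC).
    apply/upP=> x /setD1P[xl xH] xr; rewrite !inE LC //=.
    exact: (upP _ upH).
  by move/setP/(_ l); rewrite !inE eqxx lH.
pose S := C :\: H.
have dS (X : {set G}) : [disjoint X & C] -> [disjoint X & S].
  by apply: disjointWr; apply: subsetDl.
have hullK (X : {set G}) : [disjoint X & C] -> [disjoint hull X S & H].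
  move=> dX; rewrite disjoint_sym disjoint_subset; apply/subsetP=> x xH.
  by rewrite !inE (disjointFl dX (subsetP HC x xH)) xH.
(* No parent is a leaf, so pruning all of [L] at once leaves a parent-closed, hence connected, set:
   the third branch set. *)
have upHL : up (H :\: L).
  apply/upP=> x /setDP[xH xL] xr; rewrite inE (upP _ upH) // andbT.
  by apply/negP=> /LC/(_ xH xr); rewrite eqxx.
have HL : H :\: L \subset H by apply: subsetDl.
have cHL : induced_connected (H :\: L).
  apply: up_connected => //; first exact: subset_trans HL HC.
  by rewrite inE rH andbT; apply/negP=> /LP[_]; rewrite eqxx.
(* The strict bound leaves room for the root path of [p]: [p |: L] has at most [t] elements. *)
have ltL : #|L| < t.
  rewrite ltnNge; apply/negP=> tL; apply: noK.
  have LH : L \subset H by apply/subsetP=> l /LP[].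
  apply: (Kstar3_minor (A := hull A S) (B := hull B S) (K := H :\: L) (L := L)) => //.
  - exact: hull_connected.
  - exact: hull_connected.
  - by apply: hull_disjoint => //; apply: dS.
  - by apply: disjointWr HL _; apply: hullK.
  - by apply: disjointWr HL _; apply: hullK.
  - by apply: disjointWr LH _; apply: hullK.
  - by apply: disjointWr LH _; apply: hullK.
  - by rewrite -setI_eq0 setDE -setIA (setIC _ L) setICr setI0.
  - case: tAB => x xB tx; exists x; first by rewrite inE xB.
    by apply: touchS tx; apply: subsetUl.
  - exists r; last by apply: touchS tAr; apply: subsetUl.
    by rewrite inE rH andbT; apply/negP=> /LP[_]; rewrite eqxx.
  - exists p; last by apply: touchS tBp; apply: subsetUl.
    by rewrite inE pH andbT; apply/negP=> /LP[_ _]; rewrite eqxx.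
  - move=> l lL; have sl := leaf_sep l lL; split; first exact: touch_hull sl.
      by apply: (@touch_hull _ _ A); rewrite separated_sym.
    have [lH lr lp] := LP l lL.
    have [/and3P[_ _ fl] _] := fP l (subsetP HC l lH) lr.
    apply/exists_inP; exists (f l); rewrite // inE (upP _ upH) // andbT.
    by apply/negP=> /LC/(_ lH lr); rewrite eqxx.
have to_root n y : y \in H -> d y = n -> iter n f y = r.
  elim: n y => [|n IH] y yH dy; have [//|yr] := eqVneq y r.
  - by have := d_pos y (subsetP HC y yH) yr; rewrite dy.
  - by move=> yr; rewrite yr d0 in dy.
  have := d_pos y (subsetP HC y yH) yr; rewrite dy => -[dfy].
  by rewrite iterSr IH //; apply: (upP _ upH).
(* Every x in H lies on the tree path from the root to p or to a leaf. *)
have below x : x \in H ->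
    exists2 l, l \in p |: L & x = iter (d l - d x) f l /\ d x <= d l.
  have [M leM] : exists M, {in C, forall z, d z <= M}.
    by exists (\max_(z in C) d z) => z zC; apply: leq_bigmax_cond.
  (* The induction moves away from the root: a vertex that is neither [r], [p] nor a leaf has a
     child in [H], one level further. *)
  have [n] := ubnP (M - d x); elim: n x => // n IH x lexn xH.
  have [->|xr] := eqVneq x r.
    exists p; first exact: setU11.
    rewrite d0 subn0; split=> //.
    by rewrite to_root.
  have [->|xp] := eqVneq x p.
    by exists p; rewrite ?setU11 // subnn.
  have [/exists_inP[y yH /andP[yr /eqP fy]]|nx] :=
    boolP [exists y in H, (y != r) && (f y == x)]; last first.
    by exists x; [rewrite !inE xH xr xp nx orbT|rewrite subnn].
  have dy := d_pos y (subsetP HC y yH) yr; rewrite fy in dy.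
  have le_yM := leM y (subsetP HC y yH).
  have [|l lL [yl le_yl]] := IH y _ yH; first by clear -lexn dy le_yM; lia.
  exists l => //; split; last by rewrite dy in le_yl; apply: ltnW.
  by rewrite -[LHS]fy {1}yl -iterS; congr (iter _ f l); clear -dy le_yl; lia.
exists H, d; split=> //.
  split=> //; [exact: up_connected|by exists r|by exists p].
(* Each root path contributes at most one vertex to level [a]. *)
move=> a; apply: (@leq_trans #|[set iter (d l - a) f l | l in p |: L]|).
  apply/subset_leq_card/subsetP=> x; rewrite inE => /andP[/below[l lL [xl _]] /eqP<-].
  by apply/imsetP; exists l.
apply: leq_trans (leq_imset_card _ _) _.
by rewrite cardsU1; apply: leq_trans ltL; rewrite -addn1 addnC leq_add2l leq_b1.
Qed.

End Separator.

(** * Decomposition into thin connected layers *)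

Section Layering.

Variable G : sgraph.
Implicit Types (S H : {set G}) (u v w x y : G) (f : G -> nat) (i j k n : nat).

(** For [x] outside [S] this is the singleton of [x], so reflexivity holds unconditionally. *)
Definition component S x := [set y | connect (rsub S) x y].

Lemma component_refl S x : x \in component S x.
Proof. by rewrite inE connect0. Qed.

Lemma component_sub S x : x \in S -> component S x \subset S.
Proof. by move=> xS; apply/subsetP=> y; rewrite inE => /connect_rsub_mem->. Qed.

Lemma component_eq S x y : y \in component S x -> component S y = component S x.
Proof.
by rewrite inE => xy; apply/setP=> z; rewrite !inE -(same_connect (rsub_csym S) xy).
Qed.

Lemma component_step S x y z : y \in component S x -> rsub S y z -> z \in component S x.
Proof. by rewrite !inE => xy yz; apply: connect_trans xy (connect1 yz). Qed.

Lemma component_connected S x : induced_connected (component S x).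
Proof.
apply: (connected_from (component_refl S x)) => y; rewrite inE => xy.
pose P := [pred z | (z \in component S x) && connect (rsub (component S x)) x z].
suff /andP[] : P y by [].
apply: (connect_invariant _ xy) => [u v /andP[ux xu] uv|].
  have vx := component_step ux uv; rewrite /P /= vx.
  apply: connect_trans xu (connect1 _).
  by case/and3P: uv => _ _ uv; rewrite /rsub /= ux vx.
by rewrite /P /= component_refl connect0.
Qed.

Definition layer f i := [set v | f v == i].
Definition rest f i := [set v | i <= f v].

Definition touches f i v j :=
  (j < i) && [exists u in component (rest f i) v, touch (layer f j) u].

Lemma touchesP f i v j :
  reflect (j < i /\ exists2 u, u \in component (rest f i) v & touch (layer f j) u)
          (touches f i v j).
Proof. by apply: (iffP andP) => -[ji /exists_inP]. Qed.

(** Nonemptiness is left out so that empty layers qualify. The Lipschitz condition covers all of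
    [rest f i] because reaching paths wander through later layers. *)
Definition thin_layer t f i :=
  {in layer f i &, forall x y, connect (rsub (layer f i)) x y} /\
  exists2 d : G -> nat,
    forall x y, rsub (rest f i) x y -> d y <= (d x).+1
    & forall a, #|[set x in layer f i | d x == a]| <= t.

(** The candidates [a] and [b] may coincide or fail to be touched. *)
Definition two_parents f i := forall v, i <= f v ->
  exists a b, forall j, touches f i v j -> j = a \/ j = b.

Definition clique_parents f i := forall v j k, i <= f v ->
  touches f i v j -> touches f i v k -> j != k ->
  exists2 x, x \in layer f k & touch (layer f j) x.

(** With two touched layers this is [level_separator]; with at most one, the separation clause is
    vacuous. *)
Lemma next_layer t f n v :
  0 < t -> ~ is_minor (Kstar 3 t) G ->
  (forall i, i < n -> thin_layer t f i) -> two_parents f n ->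
  clique_parents f n -> f v = n ->
  exists H (d : G -> nat),
    [/\ [/\ H \subset component (rest f n) v, induced_connected H
          & forall j, touches f n v j -> exists2 x, x \in H & touch (layer f j) x],
        forall j k, touches f n v j -> touches f n v k -> j != k ->
          separated (layer f j) (layer f k) (component (rest f n) v :\: H),
        forall x y, rsub (component (rest f n) v) x y -> d y <= (d x).+1
      & forall a, #|[set x in H | d x == a]| <= t].
Proof.
move=> t_gt0 noK thin two clq fv; set C := component _ _.
have vn : v \in rest f n by rewrite inE fv.
have CR : C \subset rest f n by apply: component_sub.
have cC : induced_connected C by apply: component_connected.
have [a [b ab]] := two v (eq_leq (esym fv)).
have conn j : touches f n v j -> induced_connected (layer f j).
  case/touchesP=> jn [u _ /exists_inP[w wj _]]; split; last exact: (thin j jn).1.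
  by apply/set0Pn; exists w.
have disjC j : j < n -> [disjoint layer f j & C].
  move=> jn; rewrite disjoint_subset; apply/subsetP=> x; rewrite inE => /eqP fx.
  by apply/negP=> /(subsetP CR); rewrite inE fx leqNgt jn.
have [/and3P[ta tb nab]|one] := boolP [&& touches f n v a, touches f n v b & a != b].
  have [an tCa] := touchesP _ _ _ _ ta; have [bn tCb] := touchesP _ _ _ _ tb.
  have dab : [disjoint layer f a & layer f b].
    rewrite disjoint_subset; apply/subsetP=> x; rewrite !inE => /eqP->.
    exact: nab.
  have [H [d [[HC cH tHa tHb] sep lip lev]]] := level_separator noK (conn a ta)
    (conn b tb) cC dab (disjC a an) (disjC b bn)
    (clq v a b (eq_leq (esym fv)) ta tb nab) tCa tCb.
  exists H, d; split=> //; first by split=> // j /ab[]->.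
  move=> j k /ab[]-> /ab[]->; rewrite ?eqxx // separated_sym.
  by [].
have {a b ab one} [a ax] : exists a, forall j, touches f n v j -> j = a.
  have [ta|nta] := boolP (touches f n v a); last first.
    by exists b => j tj; case: (ab j tj) => // ja; rewrite -ja tj in nta.
  exists a => j tj; case: (ab j tj) => // jb; move: one.
  by rewrite ta /= -jb tj /= negbK => /eqP.
have [u uC tu] : exists2 u, u \in C & forall j, touches f n v j -> touch (layer f j) u.
  have [/touchesP[_ [u uC tu]]|nta] := boolP (touches f n v a).
    by exists u => // j /ax->.
  by exists v; [apply: component_refl|move=> j tj; rewrite -(ax j tj) tj in nta].
(* Only one earlier layer is touched, so a single vertex u next to it is enough. *)
exists [set u], (fun=> 0); split=> //.
- split; [by rewrite sub1set|exact: connected1|].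
  by move=> j /tu; exists u; rewrite ?inE.
- by move=> j k /ax-> /ax->; rewrite eqxx.
- move=> m; apply: leq_trans t_gt0; rewrite -(cards1 u).
  by apply/subset_leq_card/subsetP=> x /setIdP[].
Qed.

(** The invariant after [n] steps: values below [n] are final layers, and the value [n] marks
    unplaced vertices. Adjacency of touched layers is kept only at stage [n], where the next layer
    is chosen. *)
Definition layering t n f :=
  [/\ forall v, f v <= n, forall i, i < n -> thin_layer t f i,
      forall i, i <= n -> two_parents f i & clique_parents f n].

Lemma layering_step t n f v :
  0 < t -> ~ is_minor (Kstar 3 t) G -> layering t n f -> f v = n ->
  exists2 f', layering t n.+1 f' & #|rest f' n.+1| < #|rest f n|.
Proof.
move=> t_gt0 noK [fn thin two clq] fv.
have [H [d [[HC cH tH] sep lip lev]]] :=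
  next_layer t_gt0 noK thin (two n (leqnn n)) clq fv.
set C := component _ _ in HC sep lip.
have vn : v \in rest f n by rewrite inE fv.
have CR : C \subset rest f n by apply: component_sub.
have HR := subset_trans HC CR.
have fH x : x \in H -> f x = n.
  by move=> /(subsetP HR); rewrite inE => nx; apply/eqP; rewrite eqn_leq fn.
(* [H] becomes layer [n] and the other unplaced vertices move on to [n.+1], so earlier layers and
   the remainders up to [n] are unchanged. *)
pose f' x := if (f x == n) && (x \notin H) then n.+1 else f x.
have restE i : i <= n -> rest f' i = rest f i.
  move=> le_in; apply/setP=> x; rewrite !inE /f'; case: ifP => // /andP[/eqP-> _].
  by rewrite le_in leqW.
have layerE i : i < n -> layer f' i = layer f i.
  move=> lt_in; apply/setP=> x; rewrite !inE /f'; case: ifP => // /andP[/eqP-> _].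
  by rewrite !gtn_eqF // ltnW.
have layerH : layer f' n = H.
  apply/setP=> x; rewrite inE /f'; have [xH|xH] := boolP (x \in H).
    by rewrite /= andbF fH ?eqxx.
  by rewrite /= andbT; case: ifP => // _; rewrite eqn_leq ltnn.
have restS : rest f' n.+1 = rest f n :\: H.
  apply/setP=> x; rewrite !inE /f'; have [xH|xH] := boolP (x \in H).
    by rewrite /= andbF (fH x xH) ltnn.
  rewrite /= andbT; case: eqP => [->|/eqP fxn]; first by rewrite !leqnn.
  by rewrite ltn_neqAle eq_sym fxn.
have touchesE i x j : i <= n -> touches f' i x j = touches f i x j.
  move=> le_in; rewrite /touches restE //; case: (ltnP j i) => //= ji.
  by rewrite layerE //; apply: leq_trans ji le_in.
have compS x : component (rest f' n.+1) x \subset component (rest f n) x.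
  apply/subsetP=> y; rewrite !inE restS; apply: connect_rsubS.
  exact: subsetDl.
have touchesS x j : j < n -> touches f' n.+1 x j -> touches f n x j.
  move=> jn /touchesP[_ [u /(subsetP (compS x)) ux tu]].
  by apply/touchesP; split=> //; exists u; rewrite // -layerE.
(* A neighbour of [H] in [rest f n] lies in [C], so only components inside [C] see the new layer. *)
have outC x : x \in rest f' n.+1 -> touches f' n.+1 x n -> x \in C.
  move=> xR /touchesP[_ [u ux]]; rewrite layerH => /exists_inP[h hH hu].
  have uR : u \in rest f n.
    by have := subsetP (component_sub xR) u ux; rewrite restS => /setDP[].
  have uC : u \in C.
    by apply: (component_step (subsetP HC h hH)); rewrite /rsub /= (subsetP HR) // uR.
  by rewrite /C -(component_eq uC) (component_eq (subsetP (compS x) u ux)) component_refl.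
(* Separation lets a component of [C :\: H] touch at most one old layer; together with layer [n]
   this makes two. *)
have uniqC x j k : x \in C -> x \in rest f' n.+1 -> j < n -> k < n ->
    touches f' n.+1 x j -> touches f' n.+1 x k -> j = k.
  move=> xC xR jn kn tj tk; apply/eqP; apply: contraT => njk.
  have eC : component (rest f n) x = C := component_eq xC.
  have := sep j k; rewrite /touches -/C -eC.
  move=> /(_ (touchesS _ _ jn tj) (touchesS _ _ kn tk) njk).
  move/separatedP; rewrite eC.
  case/touchesP: tj => _ [y yx ty]; case/touchesP: tk => _ [z zx tz].
  rewrite !layerE // in ty tz.
  have DC : component (rest f' n.+1) x \subset C :\: H.
    rewrite subsetD -{1}eC compS /= disjoint_subset; apply/subsetP=> w.
    by move/(subsetP (component_sub xR)); rewrite restS !inE => /andP[].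
  move/(_ y z (subsetP DC y yx) (subsetP DC z zx) ty tz)/negP; case.
  by apply: connect_rsubS DC _; apply: (component_connected _ _).2.
exists f'.
  split.
  - by move=> x; rewrite /f'; case: ifP => // _; apply: leqW.
  - move=> i; rewrite ltnS leq_eqVlt => /predU1P[->|lt_in]; last first.
      by rewrite /thin_layer layerE // restE ?(ltnW lt_in) //; apply: thin.
    rewrite /thin_layer layerH restE //; split; first exact: cH.2.
    (* No edge of [rest f n] leaves [C], so extending [d] by 0 keeps it Lipschitz. *)
    exists (fun x => if x \in C then d x else 0) => [x y xy|a].
      have := component_step (S := rest f n) (x := v) _ xy; rewrite -/C => xyC.
      case: ifP => // yC.
      have xC : x \in C.
        apply: (component_step yC); rewrite /rsub /= adj_sym.
        by case/and3P: xy => -> ->.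
      by rewrite xC lip // /rsub /= xC yC; case/and3P: xy.
    apply: leq_trans (lev a); apply/subset_leq_card/subsetP=> x.
    by case/setIdP=> xH xa; rewrite (subsetP HC x xH) in xa; apply/setIdP.
  - move=> i; rewrite leq_eqVlt => /predU1P[->|le_in] x xi; last first.
      have [|a [b ab]] := two i le_in x.
        by have: x \in rest f' i; [rewrite inE|rewrite restE // inE].
      by exists a, b => j; rewrite touchesE //; apply: ab.
    have xR : x \in rest f' n.+1 by rewrite inE.
    have [tn|ntn] := boolP (touches f' n.+1 x n); last first.
      have [|a [b ab]] := two n (leqnn n) x.
        by move: xR; rewrite restS => /setDP[]; rewrite inE.
      exists a, b => j tj; apply: ab; apply: touchesS => //.
      case/andP: (tj) => + _; rewrite ltnS leq_eqVlt => /predU1P[jn|//].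
      by rewrite jn (negPf ntn) in tj.
    have xC := outC x xR tn.
    have [/existsP[a ta]|none] := boolP [exists a : 'I_n, touches f' n.+1 x a].
      exists (a : nat), n => j tj; case/andP: (tj) => + _.
      rewrite ltnS leq_eqVlt => /predU1P[->|jn]; first by right.
      by left; apply: uniqC tj ta.
    exists n, n => j tj; case/andP: (tj) => + _.
    rewrite ltnS leq_eqVlt => /predU1P[->|jn]; first by right.
    by case/existsP: none; exists (Ordinal jn).
  - move=> x j k xn tj tk njk.
    have xR : x \in rest f' n.+1 by rewrite inE.
    have xfn : n <= f x by move: xR; rewrite restS => /setDP[]; rewrite inE.
    have case_lt m : touches f' n.+1 x m -> m = n \/ m < n.
      by case/andP=> + _; rewrite ltnS leq_eqVlt => /predU1P.
    (* [H] contains a neighbour of every layer that [C] touches, which makes the new layer adjacent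
       to them. *)
    have tHn m : touches f' n.+1 x n -> touches f' n.+1 x m -> m < n ->
        exists2 y, y \in H & touch (layer f m) y.
      move=> /(outC x xR) xC /touchesS tm mn; apply: tH.
      by rewrite /touches -(component_eq xC); apply: tm.
    have [en|jn] := case_lt j tj; have [en'|kn] := case_lt k tk.
    + by rewrite en en' eqxx in njk.
    + rewrite en layerH layerE //; rewrite en in tj.
      have [y yH /exists_inP[z zk zy]] := tHn k tj tk kn.
      by exists z => //; apply/exists_inP; exists y; rewrite // adj_sym.
    + by rewrite en' layerH layerE //; rewrite en' in tk; apply: tHn.
    + by rewrite !layerE //; apply: (clq x) => //; apply: touchesS.
rewrite restS; apply: proper_card; rewrite properE subsetDl /=.
have /set0Pn[h hH] := cH.1.
by apply/subsetPn; exists h; [apply: (subsetP HR)|rewrite inE hH].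
Qed.

Lemma layering_exists t :
  0 < t -> ~ is_minor (Kstar 3 t) G ->
  exists f, (forall i, thin_layer t f i) /\ (forall i, two_parents f i).
Proof.
move=> t_gt0 noK.
have [n [f [[fn thin two _] rest0]]] : exists n f, layering t n f /\ rest f n = set0.
  have: exists n f, layering t n f.
    by exists 0, (fun=> 0); split=> // [[|i]] // _ v _; exists 0, 0.
  case=> n [f]; have [m] := ubnP #|rest f n|.
  elim: m n f => // m IH n f lt_m lay.
  have [r0|[v vR]] := set_0Vmem (rest f n); first by exists n, f.
  have fv : f v = n.
    by case: lay => fn _ _ _; apply/eqP; rewrite eqn_leq fn; rewrite inE in vR.
  have [f' lay' lt'] := layering_step t_gt0 noK lay fv.
  by apply: IH lay'; apply: leq_trans lt' _.
have fltn v : f v < n.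
  by have: v \notin rest f n; [rewrite rest0 inE|rewrite inE -ltnNge].
(* From [n] on, all layers and remainders are empty. *)
exists f; split=> i.
  have [/thin //|le_ni] := ltnP i n.
  have layer0 x : x \in layer f i = false.
    by rewrite inE ltn_eqF // (leq_trans (fltn x)).
  split; first by move=> x y; rewrite layer0.
  exists (fun=> 0) => // a; rewrite (_ : [set x in layer f i | _] = set0) ?cards0 //.
  by apply/setP=> x; rewrite [LHS]inE layer0 inE.
have [/two //|lt_ni] := leqP i n.
by move=> v; rewrite leqNgt (ltn_trans (fltn v)).
Qed.

End Layering.

(** * Counting descendants in a chordal elimination scheme of width two *)

Section ChordalReach.

Variable par : rel nat.
Hypothesis par_lt : forall i j, par i j -> j < i.
Hypothesis par_two : forall i, exists a b, forall j, par i j -> j = a \/ j = b.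
Hypothesis par_chordal : forall i a b, par i a -> par i b -> a < b -> par b a.

(** At most [r] steps, not exactly [r]: an edge of a path in the graph need not produce a step. *)
Fixpoint desc r i j :=
  if r is r'.+1 then i = j \/ exists2 k, par i k & desc r' k j else i = j.

Lemma descS r i j : desc r i j -> desc r.+1 i j.
Proof.
elim: r i => [|r IH] i /=; first by left.
by case=> [|[k ik kj]]; [left|right; exists k => //; apply: IH].
Qed.

Lemma leq_desc r s i j : r <= s -> desc r i j -> desc s i j.
Proof. by move/subnK <-; elim: (s - r) => // n IH /IH; apply: descS. Qed.

Lemma other_parent i a :
  par i a -> (forall j, par i j -> j = a) \/
  exists b, [/\ par i b, b != a & forall j, par i j -> j = a \/ j = b].
Proof.
move=> ia; have [b ab] : exists b, forall j, par i j -> j = a \/ j = b.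
  have [b [c bc]] := par_two i.
  by have [->|->] := bc a ia; [exists c|exists b => j /bc[]; [right|left]].
have [/andP[ib nba]|] := boolP (par i b && (b != a)); first by right; exists b.
rewrite negb_and negbK => h; left=> j /[dup] ij /ab[//|jb].
by rewrite -jb ij /= in h; apply/eqP.
Qed.

(* Descending from i through elements above a gives a chain: each of them has a as
   a parent, hence at most one parent above a, and the ones below a are parents
   of a by chordality. *)
Lemma desc_parent r i a : par i a ->
  exists2 s, size s <= r.+1 & forall j, desc r i j -> desc r a j \/ j \in s.
Proof.
elim: r i => [|r IH] i ia.
  by exists [:: i] => // j /= <-; right; rewrite inE.
case: (other_parent ia) => [one|[b [ib nba two]]].
  exists [:: i] => // j /= [->|[k /one-> kj]]; first by right; rewrite inE.
  by left; apply: (@descS r).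
move: nba; rewrite neq_ltn => /orP[ba|ab].
  have ab := par_chordal ib ia ba.
  exists [:: i] => // j /= [->|[k /two[]-> kj]]; first by right; rewrite inE.
    by left; apply: (@descS r).
  by left; right; exists b.
have [s ss sP] := IH b (par_chordal ia ib ab).
exists (i :: s) => // j /= [->|[k /two[]-> kj]]; first by right; rewrite inE eqxx.
  by left; apply: (@descS r).
have [aj|js] := sP j kj; first by left; apply: (@descS r).
by right; rewrite inE js orbT.
Qed.

(** Any other parent [b] exceeds [a], so by chordality [a] is a parent of [b] and [desc_parent]
    applies to [b] with the [r] steps that remain. *)
Lemma desc_min_parent r i a : par i a -> (forall b, par i b -> a <= b) ->
  exists2 s, size s <= r.+2 & forall j, desc r.+1 i j -> desc r a j \/ j \in s.
Proof.
move=> ia min_a; case: (other_parent ia) => [one|[b [ib nba two]]].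
  by exists [:: i] => // j /= [->|[k /one-> kj]]; [right; rewrite inE|left].
have ab : a < b by rewrite ltn_neqAle eq_sym nba min_a.
have [s ss sP] := desc_parent r (par_chordal ia ib ab).
exists (i :: s) => // j /= [->|[k /two[]-> kj]]; first by right; rewrite inE eqxx.
  by left.
have [|js] := sP j kj; first by left.
by right; rewrite inE js orbT.
Qed.

(** Passing to the least parent gives the recurrence N(r+1) <= N(r) + r + 2 with N(0) = 1, solved by
    the binomial coefficient. *)
Lemma desc_bound r i :
  exists2 s, size s <= 'C(r + 2, 2) & forall j, desc r i j -> j \in s.
Proof.
elim: r i => [|r IH] i.
  by exists [:: i] => // j /= ->; rewrite inE.
have [/existsP[a0 ia0]|none] := boolP [exists a : 'I_i, par i a]; last first.
  exists [:: i]; first by rewrite bin_gt0 addn2.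
  move=> j /= [->|[k ik _]]; first by rewrite inE.
  by case/existsP: none; exists (Ordinal (par_lt ik)).
have [a ia min_a] := ex_minnP (ex_intro (fun a => par i a) _ ia0).
have [s ss sP] := desc_min_parent r ia min_a.
have [s' ss' sP'] := IH a.
exists (s' ++ s).
  by rewrite size_cat addSn binS bin1 leq_add // addn2.
by move=> j /sP[/sP'|]; rewrite mem_cat => ->; rewrite ?orbT.
Qed.

End ChordalReach.

(** * Counting reachable vertices layer by layer *)

Lemma leq_card_cover (T : finType) (I : eqType) (A : {set T}) (F : I -> {set T})
    (s : seq I) m :
  (forall x, x \in A -> exists2 i, i \in s & x \in F i) ->
  (forall i, i \in s -> #|F i| <= m) -> #|A| <= size s * m.
Proof.
elim: s A => [|i s IH] A cov le_m.
  rewrite leqn0 cards_eq0; apply/eqP/setP=> x; rewrite inE.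
  by apply/negP=> /cov[].
rewrite -(cardsID (F i) A) /= mulSn leq_add //.
  by apply: leq_trans (le_m i (mem_head _ _)); apply/subset_leq_card/subsetIr.
apply: IH => [x /setDP[/cov[j]]|j js]; last by rewrite le_m // inE js orbT.
by rewrite inE => /predU1P[-> ->|js xF _] //; exists j.
Qed.

Section Counting.

Variables (G : sgraph) (t : nat) (f : G -> nat).
Hypothesis thin : forall i, thin_layer t f i.
Hypothesis two : forall i, two_parents f i.

Implicit Types (u v w x y : G) (i j k n r : nat).

(** The choice of [v] is immaterial, since a connected layer lies in one component of [rest f i];
    see [par_touches]. *)
Definition par : rel nat := fun i j => [exists v in layer f i, touches f i v j].

Lemma par_lt i j : par i j -> j < i.
Proof. by case/exists_inP=> v _ /andP[]. Qed.

Lemma layer_comp i v w : f v = i -> f w = i -> w \in component (rest f i) v.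
Proof.
move=> fv fw; rewrite inE.
have sub : layer f i \subset rest f i.
  by apply/subsetP=> x; rewrite !inE => /eqP->.
by apply: (connect_rsubS sub); apply: (thin i).1; rewrite inE ?fv ?fw.
Qed.

Lemma par_touches i v j : f v = i -> par i j -> touches f i v j.
Proof.
move=> fv /exists_inP[w]; rewrite inE => /eqP fw.
by rewrite /touches (component_eq (layer_comp fv fw)).
Qed.

Lemma par_two i : exists a b, forall j, par i j -> j = a \/ j = b.
Proof.
have [/existsP[v /eqP fv]|none] := boolP [exists v, f v == i].
  have [a [b ab]] := two (eq_leq (esym fv)).
  by exists a, b => j /(par_touches fv)/ab.
exists 0, 0 => j /exists_inP[v]; rewrite inE => fv.
by case/existsP: none; exists v.
Qed.

(** The edge from [w] in layer [b] puts the component of [v] in [rest f i] inside the component of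
    [w] in the larger [rest f b], which therefore touches layer [a] too. *)
Lemma par_chordal i a b : par i a -> par i b -> a < b -> par b a.
Proof.
move=> ia ib ab; have lt_bi := par_lt ib.
have /exists_inP[v vi /touchesP[_ [u uv tu]]] := ib.
have fv : f v = i by apply/eqP; rewrite inE in vi.
have /touchesP[_ [u' u'v tu']] := par_touches fv ia.
have RS : rest f i \subset rest f b.
  by apply/subsetP=> x; rewrite !inE; apply: leq_trans (ltnW lt_bi).
have vR : v \in rest f i by rewrite inE fv.
have [w wb wu] := exists_inP tu.
have compS x : x \in component (rest f i) v -> x \in component (rest f b) v.
  by rewrite !inE; apply: connect_rsubS.
apply/exists_inP; exists w => //; apply/touchesP; split=> //.
exists u' => //; suff -> : component (rest f b) w = component (rest f b) v by apply: compS.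
apply: component_eq; apply: component_step (compS u uv) _.
rewrite inE in wb.
rewrite /rsub /= adj_sym wu andbT (subsetP RS) ?(subsetP (component_sub vR)) //=.
by rewrite inE (eqP wb).
Qed.

(* The index i is the least layer met so far, and v is still in a component of
   rest f i that meets layer i. *)
Lemma path_desc i v p :
  v \in rest f i -> layer f i :&: component (rest f i) v != set0 ->
  path (@adj G) v p -> {in v :: p, forall w, f (last v p) <= f w} ->
  f (last v p) <= i -> desc par (size p) i (f (last v p)).
Proof.
elim: p i v => [|u p IH] i v /= vR vC.
  move=> _ _ le_vi; apply/eqP; rewrite eqn_leq le_vi andbT.
  by rewrite inE in vR.
case/andP=> vu up ge_last le_i.
have ge' : {in u :: p, forall w, f (last u p) <= f w}.
  by move=> w wp; apply: ge_last; rewrite inE wp orbT.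
have [le_iu|lt_ui] := leqP i (f u).
  have uR : u \in rest f i by rewrite inE.
  apply: (@descS par (size p) i); apply: IH => //.
  suff -> : component (rest f i) u = component (rest f i) v by [].
  by apply: component_eq; apply: component_step (component_refl _ _) _;
  rewrite /rsub /= vR uR.
(* The path drops below [i] here: the component of [v] meets layer [i] and touches layer [f u],
   which is one [par] step. *)
right; exists (f u); last first.
  apply: IH => //; first by rewrite inE.
    by apply/set0Pn; exists u; rewrite inE component_refl inE eqxx.
  by apply: ge'; rewrite mem_head.
have [w /setIP[wi wv]] := set0Pn _ vC.
apply/exists_inP; exists w => //; apply/touchesP; split=> //.
exists v; first by rewrite (component_eq wv) component_refl.
by apply/exists_inP; exists u; rewrite ?inE // adj_sym.
Qed.

(** The path stays in one component of [rest f i] until its final edge, which shows that this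
    component touches layer [f u]. *)
Lemma path_par i v p u :
  v \in rest f i -> layer f i :&: component (rest f i) v != set0 ->
  path (@adj G) v (rcons p u) -> {in p, forall w, i <= f w} ->
  f u < i -> par i (f u).
Proof.
elim: p v => [|x p IH] v /= vR vC.
  rewrite andbT => vu _ lt_ui; have [w /setIP[wi wv]] := set0Pn _ vC.
  apply/exists_inP; exists w => //; apply/touchesP; split=> //.
  exists v; first by rewrite (component_eq wv) component_refl.
  by apply/exists_inP; exists u; rewrite ?inE // adj_sym.
case/andP=> vx xp ge_p; have xR : x \in rest f i by rewrite inE ge_p ?mem_head.
apply: (IH x) => //; last by move=> w wp; apply: ge_p; rewrite inE wp orbT.
suff -> : component (rest f i) x = component (rest f i) v by [].
by apply: component_eq; apply: component_step (component_refl _ _) _;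
  rewrite /rsub /= vR xR.
Qed.

(** Along such a path [d] moves at most [r] away from [d v], which leaves [2 * r + 1] levels of at
    most [t] vertices. *)
Lemma layer_slice_bound r v (A : {set G}) j :
  {in A, forall x, f x = j /\ exists p,
     [/\ size p <= r, path (@adj G) v p, last v p = x
       & {in v :: p, forall w, j <= f w}]} ->
  #|A| <= (2 * r + 1) * t.
Proof.
move=> AP; have [_ [d lip lev]] := thin j.
have lip_path p u : path (@adj G) u p -> {in u :: p, forall w, j <= f w} ->
    d (last u p) <= d u + size p /\ d u <= d (last u p) + size p.
  elim: p u => [|w p IH] u /=; first by rewrite addn0.
  case/andP=> uw wp ge_j.
  have [|le1 le2] := IH w wp.
    by move=> z zp; apply: ge_j; rewrite inE zp orbT.
  have uR : u \in rest f j by rewrite inE ge_j ?mem_head.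
  have wR : w \in rest f j by rewrite inE ge_j // !inE eqxx orbT.
  have := lip u w; have := lip w u; rewrite /rsub /= uR wR uw adj_sym uw.
  by move=> /(_ isT) le3 /(_ isT) le4; clear -le1 le2 le3 le4; lia.
rewrite -(size_iota 0 (2 * r + 1)).
apply: (leq_card_cover (F := fun c => [set x in layer f j | d x == d v + c - r])) => //.
move=> x /AP[fx [p [sp vp lp ge_j]]].
have [le1 le2] := lip_path p v vp ge_j; rewrite lp in le1 le2.
(* The difference of levels is shifted by [r]; nothing is truncated, as [d v <= d x + r]. *)
exists (d x + r - d v).
  by rewrite mem_iota; clear -le1 le2 sp; lia.
by rewrite !inE fx eqxx /=; apply/eqP; clear -le1 le2 sp; lia.
Qed.

Definition layer_order : rel G :=
  fun x y => (f x < f y) || (f x == f y) && (enum_rank x <= enum_rank y).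

Lemma layer_order_linear : linear_order layer_order.
Proof.
apply/linear_orderP; rewrite /layer_order; split.
- by move=> x; rewrite eqxx leqnn orbT.
- move=> x y h; apply/enum_rank_inj/ord_inj; move: h.
  lia.
- by move=> y x z; lia.
- by move=> x y; lia.
Qed.

Lemma layer_order_leq x y : layer_order x y -> f x <= f y.
Proof. by rewrite /layer_order; lia. Qed.

Lemma gpath_split n v x (p : n.-tuple G) :
  gpath v x p -> x = v \/
  exists q, [/\ (p : seq G) = rcons q x, path (@adj G) v (rcons q x)
              & interior v p = q].
Proof.
rewrite /gpath /interior => /and3P[vp _ /eqP lp].
case/lastP: (tval p) vp lp => [|q y] vp.
  by left.
rewrite last_rcons => yx; right; exists q; rewrite -yx.
by rewrite belast_rcons.
Qed.

Lemma rest_self v : v \in rest f (f v).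
Proof. by rewrite inE. Qed.

Lemma layer_comp_self v : layer f (f v) :&: component (rest f (f v)) v != set0.
Proof. by apply/set0Pn; exists v; rewrite inE component_refl inE eqxx. Qed.

(** The interior follows [v] in the order, so only the last edge can drop to an earlier layer. *)
Lemma Sreach_path r v x :
  x \in Sreach layer_order r v ->
  (f x = f v \/ par (f v) (f x)) /\ exists p,
    [/\ size p <= r, path (@adj G) v p, last v p = x
      & {in v :: p, forall w, f x <= f w}].
Proof.
rewrite inE => /andP[/layer_order_leq le_xv].
case/existsP=> n /existsP[p /andP[vp /allP int_p]].
have le_nr : n <= r by rewrite -ltnS.
have [->|[q [pq vq iq]]] := gpath_split vp.
  split; first by left.
  by exists [::]; split=> // w; rewrite inE => /eqP->.
have ge_v w : w \in q -> f v <= f w.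
  by rewrite -iq => /int_p /andP[_ /layer_order_leq].
split.
  have [lt_xv|le_vx] := ltnP (f x) (f v); last first.
    by left; apply/eqP; rewrite eqn_leq le_xv.
  by right; apply: path_par (rest_self v) (layer_comp_self v) vq ge_v lt_xv.
exists (rcons q x); split; rewrite ?last_rcons // -?pq ?size_tuple //.
move=> w; rewrite pq inE mem_rcons inE => /or3P[/eqP->|/eqP->|/ge_v] //.
exact: leq_trans.
Qed.

(** The interior only has to follow [x], so several drops may occur; [path_desc] turns them into
    [par] steps. *)
Lemma Wreach_path r v x :
  x \in Wreach layer_order r v ->
  desc par r (f v) (f x) /\ exists p,
    [/\ size p <= r, path (@adj G) v p, last v p = x
      & {in v :: p, forall w, f x <= f w}].
Proof.
rewrite inE => /andP[/layer_order_leq le_xv].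
case/existsP=> n /existsP[p /andP[vp /allP int_p]].
have le_nr : n <= r by rewrite -ltnS.
suff [q [sq vq lq ge_x]] : exists q, [/\ size q <= r, path (@adj G) v q,
    last v q = x & {in v :: q, forall w, f x <= f w}].
  split; last by exists q.
  apply: (leq_desc sq); rewrite -lq.
  by apply: path_desc (rest_self v) (layer_comp_self v) vq _ _; rewrite lq.
have [->|[q [pq vq iq]]] := gpath_split vp.
  by exists [::]; split=> // w; rewrite inE => /eqP->.
exists (rcons q x); split; rewrite ?last_rcons // -?pq ?size_tuple //.
move=> w; rewrite pq inE mem_rcons inE => /or3P[/eqP->|/eqP->|] //.
by rewrite -iq => /int_p /andP[_ /layer_order_leq].
Qed.

Lemma scol_layering r : scol G r <= 3 * ((2 * r + 1) * t).
Proof.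
apply/scol_leP; exists layer_order; first exact: layer_order_linear.
move=> v; have [a [b ab]] := par_two (f v).
rewrite -[3]/(size [:: f v; a; b]).
apply: (leq_card_cover (F := fun j => [set x in Sreach layer_order r v | f x == j])).
  move=> x xS; exists (f x); last by rewrite inE xS /=.
  have [h _] := Sreach_path xS; rewrite !inE.
  by case: h => [->|/ab[]->]; rewrite eqxx ?orbT.
move=> j _; apply: (@layer_slice_bound r v _ j) => x /setIdP[/Sreach_path[_ +] /eqP fx].
by rewrite fx.
Qed.

Lemma wcol_layering r : wcol G r <= 'C(r + 2, 2) * ((2 * r + 1) * t).
Proof.
apply/wcol_leP; exists layer_order; first exact: layer_order_linear.
move=> v; have [s ss sP] := desc_bound par_lt par_two par_chordal r (f v).
apply: leq_trans (leq_mul ss (leqnn _)).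
apply: (leq_card_cover (F := fun j => [set x in Wreach layer_order r v | f x == j])).
  move=> x xS; exists (f x); last by rewrite inE xS /=.
  by apply: sP; apply: (Wreach_path xS).1.
move=> j _; apply: (@layer_slice_bound r v _ j) => x /setIdP[/Wreach_path[_ +] /eqP fx].
by rewrite fx.
Qed.

End Counting.

Theorem theorem25 :
  forall t : nat, 1 <= t ->
  forall G : sgraph, ~ is_minor (Kstar 3 t) G ->
  forall r : nat, 1 <= r ->
    scol G r <= 3 * (2 * t + 1) * (2 * r + 1) /\
    wcol G r <= (2 * t + 1) * 'C(r + 2, 2) * (2 * r + 1).
Proof.
move=> t t_gt0 G noK r _.
have [f [thin two]] := layering_exists t_gt0 noK.
(* The layers give the factor [t], which is now weakened. *)
have le_t : t <= 2 * t + 1 by lia.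
split.
  apply: leq_trans (scol_layering thin two r) _.
  by rewrite -mulnA [_ * t]mulnC !leq_mul.
apply: leq_trans (wcol_layering thin two r) _.
by rewrite [_ * t]mulnC mulnA ['C(_, _) * t]mulnC !leq_mul.
Qed.
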